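(* The HNN normal form $t^pV(t_1,t_2)W(a,b)$ of a 4-strand braid is not logspace computable; that is, there is no deterministic logspace transducer which, on input a word over $\{a,b,t_1,t_2,t\}^{\pm 1}$ representing a braid $\beta\in B_4$, outputs the word $t^pV(t_1,t_2)W(a,b)$ that is the HNN normal form of $\beta$.
   Context: $B_4=\langle \sigma_1,\sigma_2,\sigma_3\mid \sigma_1\sigma_3=\sigma_3\sigma_1,\ \sigma_1\sigma_2\sigma_1=\sigma_2\sigma_1\sigma_2,\ \sigma_2\sigma_3\sigma_2=\sigma_3\sigma_2\sigma_3\rangle$ is the 4-strand braid group. It is generated by the elements $t=\sigma_1$, $t_1=\sigma_1\sigma_2\sigma_1^{-2}$, $t_2=\sigma_2\sigma_1^{-1}$, $a=\sigma_1\sigma_2\sigma_1^{-1}\sigma_3\sigma_2^{-1}\sigma_1^{-1}$, $b=\sigma_3\sigma_1^{-1}$. The subgroups $\langle a,b\rangle$ and $\langle t_1,t_2\rangle$ are free of rank 2, the commutator subgroup $[B_4,B_4]$ is the semidirect product of the normal subgroup $\langle a,b\rangle$ with $\langle t_1,t_2\rangle$, and $B_4$ is the semidirect product of $[B_4,B_4]$ with $\langle t\rangle\cong\mathbb{Z}$. HNN normal form. Every $\beta\in B_4$ has a unique representation $t^p\cdot VW$ with $p\in\mathbb{Z}$, $V=V(t_1,t_2)$ a freely reduced group word over $\{t_1,t_2\}$ and $W=W(a,b)$ a freely reduced group word over $\{a,b\}$. This is called the (left) HNN normal form of $\beta$. Logspace transducer. A deterministic logspace transducer consists of a finite state control, a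 read-only input tape, a read-write work tape restricted to at most $c\log n$ squares ($n$ the input length, $c$ a fixed constant), and a write-only output tape written left to right; on each transition it can modify the work tape, change state, move the input head, and write at most a fixed number of letters to the output tape. *)

(* Defs.v *)
(* boolp makes the congruence of a presentation decidable, so that presented
   groups are quotient types. *)
From HB Require Import structures.
From mathcomp Require Import all_boot ssralg ssrnum ssrint.
From mathcomp Require Import boolp.

Set Implicit Arguments.
Unset Strict Implicit.
Unset Printing Implicit Defensive.

Local Open Scope quotient_scope.
Local Open Scope group_scope.

(* The letter (x, false) stands for x and (x, true) for x^-1. *)
Notation letter X := (X * bool)%type.
Notation word X := (seq (letter X)).

Definition inv_letter (X : Type) (l : letter X) : letter X := (l.1, ~~ l.2).
Definition inv_word (X : Type) (w : word X) : word X :=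
  rev (map (@inv_letter X) w).

Definition freely_reduced (X : eqType) (w : word X) : bool :=
  sorted (fun l m : letter X => m != inv_letter l) w.

Definition eval_letter (X : Type) (G : groupType) (f : X -> G) (l : letter X)
  : G := if l.2 then (f l.1)^-1 else f l.1.
Definition eval_word (X : Type) (G : groupType) (f : X -> G) (w : word X) : G :=
  \prod_(l <- w) eval_letter f l.

(* A pair (u, v) in R is the relation u = v. *)
Inductive pres_eq (X : eqType) (R : seq (word X * word X)) :
    word X -> word X -> Prop :=
| PresRefl u : pres_eq R u u
| PresSym u v : pres_eq R u v -> pres_eq R v u
| PresTrans u v w : pres_eq R u v -> pres_eq R v w -> pres_eq R u w
| PresCat u u' v v' :
    pres_eq R u u' -> pres_eq R v v' -> pres_eq R (u ++ v) (u' ++ v')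
| PresCancel l : pres_eq R [:: l; inv_letter l] [::]
| PresRel u v : (u, v) \in R -> pres_eq R u v.

Section PresentedGroup.
Variables (X : choiceType) (R : seq (word X * word X)).

Definition pres_eqb (u v : word X) : bool := `[< pres_eq R u v >].

Fact pres_eqb_refl : reflexive pres_eqb.
Proof. by move=> u; apply/asboolP; exact: PresRefl. Qed.
Fact pres_eqb_sym : symmetric pres_eqb.
Proof. by move=> u v; apply/asboolP/asboolP; exact: PresSym. Qed.
Fact pres_eqb_trans : transitive pres_eqb.
Proof.
by move=> v u w /asboolP uv /asboolP vw; apply/asboolP; exact: PresTrans uv vw.
Qed.

Canonical pres_equiv := EquivRel pres_eqb pres_eqb_refl pres_eqb_sym pres_eqb_trans.

Definition presented : Type := {eq_quot pres_equiv}.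
HB.instance Definition _ := Choice.on presented.

Definition class_of (w : word X) : presented := \pi_{eq_quot pres_equiv} w.
Definition rep_of (x : presented) : word X :=
  repr (x : {eq_quot pres_equiv}).

Lemma class_of_eqP u v : class_of u = class_of v <-> pres_eq R u v.
Proof.
split; first by move=> /eqmodP /asboolP.
by move=> uv; apply/eqmodP/asboolP.
Qed.

Lemma rep_ofK : cancel rep_of class_of.
Proof. by move=> x; exact: reprK. Qed.

Lemma rep_of_class u : pres_eq R (rep_of (class_of u)) u.
Proof. by apply/class_of_eqP; rewrite rep_ofK. Qed.

Definition pres_one : presented := class_of [::].
Definition pres_mul (x y : presented) : presented :=
  class_of (rep_of x ++ rep_of y).
Definition pres_inv (x : presented) : presented :=
  class_of (inv_word (rep_of x)).

Lemma class_of_cat u v : class_of (u ++ v) = pres_mul (class_of u) (class_of v).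
Proof.
by apply/class_of_eqP; apply: PresCat; apply: PresSym; exact: rep_of_class.
Qed.

Fact inv_letterK : involutive (@inv_letter X).
Proof. by case=> x b; rewrite /inv_letter /= negbK. Qed.

Fact inv_wordK : involutive (@inv_word X).
Proof.
by move=> w; rewrite /inv_word map_rev revK -map_comp map_id_in // => l _ /=;
  exact: inv_letterK.
Qed.

Fact pres_eq_mulwV u : pres_eq R (u ++ inv_word u) [::].
Proof.
elim: u => [|l u IHu]; first exact: PresRefl.
rewrite /inv_word map_cons rev_cons -cats1 -/(inv_word u).
rewrite catA -cat1s -(catA [:: l]) -catA.
apply: PresTrans (PresCancel R l); rewrite -[X in pres_eq _ _ X]/([:: l] ++ _).
apply: PresCat; first exact: PresRefl.
rewrite -[X in pres_eq _ _ X]cat0s.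
by apply: PresCat; [exact: IHu | exact: PresRefl].
Qed.

Fact pres_mulA : associative pres_mul.
Proof.
move=> x y z; rewrite -(rep_ofK x) -(rep_ofK y) -(rep_ofK z).
by rewrite -!class_of_cat catA.
Qed.

Fact pres_mul1 : left_id pres_one pres_mul.
Proof. by move=> x; rewrite -(rep_ofK x) -class_of_cat. Qed.

Fact pres_mulr1 : right_id pres_one pres_mul.
Proof. by move=> x; rewrite -(rep_ofK x) -class_of_cat cats0. Qed.

Fact pres_mulV : left_inverse pres_one pres_inv pres_mul.
Proof.
move=> x; rewrite -{2}(rep_ofK x) -class_of_cat; apply/class_of_eqP.
by rewrite -{2}(inv_wordK (rep_of x)); exact: pres_eq_mulwV.
Qed.

Fact pres_mulrV : right_inverse pres_one pres_inv pres_mul.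
Proof.
move=> x; rewrite -{1}(rep_ofK x) -class_of_cat; apply/class_of_eqP.
exact: pres_eq_mulwV.
Qed.

HB.instance Definition _ := isGroup.Build presented
  pres_mulA pres_mul1 pres_mulr1 pres_mulV pres_mulrV.

Definition pres_gen (x : X) : presented := class_of [:: (x, false)].

End PresentedGroup.

Variant artin_gen := Sigma1 | Sigma2 | Sigma3.

Definition artin_gen_to_ord (x : artin_gen) : 'I_3 :=
  match x with
  | Sigma1 => @Ordinal 3 0 isT
  | Sigma2 => @Ordinal 3 1 isT
  | Sigma3 => @Ordinal 3 2 isT
  end.
Definition ord_to_artin_gen (i : 'I_3) : artin_gen :=
  match val i with 0 => Sigma1 | 1 => Sigma2 | _ => Sigma3 end.
Fact artin_gen_to_ordK : cancel artin_gen_to_ord ord_to_artin_gen.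
Proof. by case. Qed.
HB.instance Definition _ := Finite.copy artin_gen (can_type artin_gen_to_ordK).

Definition braid_relations : seq (word artin_gen * word artin_gen) :=
  let s1 := (Sigma1, false) in
  let s2 := (Sigma2, false) in
  let s3 := (Sigma3, false) in
  [:: ([:: s1; s3],     [:: s3; s1]);
      ([:: s1; s2; s1], [:: s2; s1; s2]);
      ([:: s2; s3; s2], [:: s3; s2; s3])].

Definition B4 : groupType := presented braid_relations.

Definition sigma1 : B4 := pres_gen braid_relations Sigma1.
Definition sigma2 : B4 := pres_gen braid_relations Sigma2.
Definition sigma3 : B4 := pres_gen braid_relations Sigma3.

Variant hnn_gen := Ga | Gb | Gt1 | Gt2 | Gt.

Definition hnn_gen_to_ord (x : hnn_gen) : 'I_5 :=
  match x with
  | Ga => @Ordinal 5 0 isT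
  | Gb => @Ordinal 5 1 isT
  | Gt1 => @Ordinal 5 2 isT
  | Gt2 => @Ordinal 5 3 isT
  | Gt => @Ordinal 5 4 isT
  end.
Definition ord_to_hnn_gen (i : 'I_5) : hnn_gen :=
  match val i with
  | 0 => Ga | 1 => Gb | 2 => Gt1 | 3 => Gt2 | _ => Gt
  end.
Fact hnn_gen_to_ordK : cancel hnn_gen_to_ord ord_to_hnn_gen.
Proof. by case. Qed.
HB.instance Definition _ := Finite.copy hnn_gen (can_type hnn_gen_to_ordK).

Definition hnn_val (x : hnn_gen) : B4 :=
  match x with
  | Ga  => sigma1 * sigma2 * sigma1^-1 * sigma3 * sigma2^-1 * sigma1^-1
  | Gb  => sigma3 * sigma1^-1
  | Gt1 => sigma1 * sigma2 * sigma1 ^- 2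
  | Gt2 => sigma2 * sigma1^-1
  | Gt  => sigma1
  end.

Definition braid_of_word (w : word hnn_gen) : B4 := eval_word hnn_val w.

Definition over (S : seq hnn_gen) (w : word hnn_gen) : bool :=
  all (fun l : letter hnn_gen => l.1 \in S) w.

Definition t_power (p : int) : word hnn_gen :=
  nseq `|p|%N (Gt, (p < 0)%R).

Definition is_HNN_normal_form (beta : B4) (w : word hnn_gen) : Prop :=
  braid_of_word w = beta /\
  exists (p : int) (V W : word hnn_gen),
    [/\ w = t_power p ++ V ++ W,
        over [:: Gt1; Gt2] V && freely_reduced V
      & over [:: Ga; Gb] W && freely_reduced W].

Variant direction := GoLeft | Stay | GoRight.

(* The input tape carries the input word between two end markers. *)
Variant input_symbol (A : Type) := LeftEnd | Letter of A | RightEnd.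
Arguments LeftEnd {A}.
Arguments RightEnd {A}.

Record action (Q S B : Type) := Action {
  new_state : Q;
  written_symbol : S;
  input_move : direction;
  work_move : direction;
  emitted : seq B
}.

(* [delta] returns None when the machine halts.  When A is finite, [delta] has
   a finite domain, so the number of letters emitted by a single transition is
   bounded by a constant depending only on the machine. *)
Record transducer (A : finType) (B : Type) := Transducer {
  state : finType;
  work_symbol : finType;
  blank : work_symbol;
  initial_state : state;
  delta : state -> input_symbol A -> work_symbol ->
          option (action state work_symbol B)
}.

Section Runs.
Variables (A : finType) (B : Type) (T : transducer A B).

(* The letters of the input are at positions 1, ..., n of the input tape, and
   the end markers at positions 0 and n + 1.  The work tape is infinite to the
   right; the space restriction is imposed by [logspace] below.  The output
   tape is write-only, hence not part of the configuration. *)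
Record config := Config {
  cur_state : state T;
  input_pos : nat;
  work_pos : nat;
  work_tape : nat -> work_symbol T
}.

Definition initial_config : config :=
  Config (initial_state T) 0 0 (fun=> blank T).

Definition read_input (w : seq A) (i : nat) : input_symbol A :=
  if i is j.+1 then if onth w j is Some x then Letter x else RightEnd
  else LeftEnd.

Definition move_work (d : direction) (i : nat) : nat :=
  match d with GoLeft => i.-1 | Stay => i | GoRight => i.+1 end.

Definition move_input (n : nat) (d : direction) (i : nat) : nat :=
  minn (move_work d i) n.+1.

Definition step (w : seq A) (c : config) : option (config * seq B) :=
  omap (fun act : action (state T) (work_symbol T) B =>
          (Config (new_state act)
                  (move_input (size w) (input_move act) (input_pos c))
                  (move_work (work_move act) (work_pos c))
                  [eta work_tape c with work_pos c |-> written_symbol act],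
           emitted act))
       (delta (cur_state c) (read_input w (input_pos c))
              (work_tape c (work_pos c))).

Inductive reachable (w : seq A) : config -> Prop :=
| ReachInit : reachable w initial_config
| ReachStep c c' v :
    reachable w c -> step w c = Some (c', v) -> reachable w c'.

Inductive halts_from (w : seq A) : config -> seq B -> Prop :=
| HaltNow c : step w c = None -> halts_from w c [::]
| HaltStep c c' v v' :
    step w c = Some (c', v) -> halts_from w c' v' ->
    halts_from w c (v ++ v').

Definition outputs (w : seq A) (v : seq B) : Prop :=
  halts_from w initial_config v.

(* (trunc_log 2 n).+1, the binary length of n, plays the role of log n: a
   machine scans at least one square, so log n itself would exclude every
   machine on inputs of length at most 1. *)
Definition logspace : Prop :=
  exists c : nat, forall (w : seq A) (k : config),
    reachable w k -> (work_pos k < c * (trunc_log 2 (size w)).+1)%N.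

End Runs.

(* Main.v *)
Require Import Defs.
From mathcomp Require Import all_boot.
From mathcomp Require Import ssralg ssrint boolp.
From mathcomp Require Import zify ring.

Set Implicit Arguments.
Unset Strict Implicit.
Unset Printing Implicit Defensive.

Import GRing.Theory.

(** The normal form cannot be computed in logarithmic space because it can be
    exponentially longer than the input, whereas a logspace transducer has
    output of polynomial length.

    For the lower bound, let B4 act on Z^2 by the integral affine maps
      s1 (x, y) = (x + y, y),      s2 (x, y) = (x, y - x),
      s3 (x, y) = (x + y + 1, y).
    The elements a and b act as translations by (0, -1) and (1, 0), while t, t1
    and t2 fix the origin.  Suppose that beta acts as the translation by u and
    that beta = t^p V W with V a word in t1, t2 and W a word in a, b.  Then W
    acts as the translation by some u' whose l1 norm is at most the length of
    W, and the point - u' is sent by W to the origin and then left there by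
    t^p V; so u - u' = 0.  Hence any such expression of beta has length at
    least the l1 norm of u (normal_form_length).
    Since t2 acts as the hyperbolic linear map
    (x, y) |-> (x - y, 2 y - x), the braid t2^n a t2^-n, given by a word of
    length 2 n + 1, is a translation of norm at least 2^n
    (stretched_a_translation).

    For the upper bound, a deterministic machine that halts never repeats a
    configuration, so it makes fewer steps than it has reachable
    configurations; on an input of length n there are at most
    2^(d (log n + 1)) of these, for a constant d, if the work head visits only
    O(log n) squares (logspace_output_poly). *)

(** * An affine action of the braid group on the integral plane *)

Notation plane := (int * int)%type.

(** The linear parts generate SL2(Z), through the map of B4 onto B3 that sends
    s3 to s1.  The maps of s1 and s3 differ by the translation by (1, 0), and
    they commute because s1 fixes this vector. *)
Definition artin_act (l : letter artin_gen) (p : plane) : plane :=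
  let: (x, y) := p in
  match l with
  | (Sigma1, false) => (x + y, y)
  | (Sigma1, true) => (x - y, y)
  | (Sigma2, false) => (x, y - x)
  | (Sigma2, true) => (x, y + x)
  | (Sigma3, false) => (x + y + 1, y)
  | (Sigma3, true) => (x - y - 1, y)
  end%R.

Definition artin_word_act (w : word artin_gen) (p : plane) : plane :=
  foldr artin_act p w.

Lemma artin_word_act_pres u v :
  pres_eq braid_relations u v -> artin_word_act u =1 artin_word_act v.
Proof.
elim=> [// | u' v' _ IH p | u1 u2 u3 _ IH1 _ IH2 p | u1 u2 v1 v2 _ IHu _ IHv p
       | [[] []] [x y] | u' v'].
- by rewrite IH.
- by rewrite IH1.
- by rewrite /artin_word_act !foldr_cat -/(artin_word_act v1 p) IHv; exact: IHu.
1-6: by rewrite /artin_word_act /=; congr pair; ring.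
rewrite !inE => /or3P[] /eqP[-> ->] [x y];
  by rewrite /artin_word_act /=; congr pair; ring.
Qed.

Definition braid_act (g : B4) : plane -> plane := artin_word_act (rep_of g).

Lemma braid_act_class w :
  braid_act (class_of braid_relations w) =1 artin_word_act w.
Proof. by apply: artin_word_act_pres; exact: rep_of_class. Qed.

Lemma braid_act1 p : braid_act 1%g p = p.
Proof. exact: braid_act_class. Qed.

Lemma braid_actM g h p : braid_act (g * h)%g p = braid_act g (braid_act h p).
Proof. by rewrite braid_act_class /artin_word_act foldr_cat. Qed.

Lemma braid_actK g : cancel (braid_act g) (braid_act g^-1%g).
Proof. by move=> p; rewrite -braid_actM mulVg braid_act1. Qed.

Lemma braid_actVK g : cancel (braid_act g^-1%g) (braid_act g).
Proof. by move=> p; rewrite -braid_actM mulgV braid_act1. Qed.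

(** The inverse in B4 is defined through representatives; with this lemma the
    action of an inverse can be computed on any word. *)
Lemma braid_actV_class w :
  braid_act (class_of braid_relations w)^-1%g =1 artin_word_act (inv_word w).
Proof.
move=> p; rewrite -[RHS]braid_act_class.
apply: (can_inj (braid_actK (class_of braid_relations w))).
rewrite braid_actVK -braid_actM.
rewrite -[(_ * _)%g](class_of_cat braid_relations w (inv_word w)).
by rewrite braid_act_class (artin_word_act_pres (pres_eq_mulwV _ w)).
Qed.

Definition translation_by (v : plane) (g : B4) : Prop :=
  forall p, braid_act g p = (p + v)%R.

Lemma translation1 : translation_by 0%R 1%g.
Proof. by move=> p; rewrite braid_act1 addr0. Qed.

Lemma translationM u v g h :
  translation_by u g -> translation_by v h ->
  translation_by (u + v)%R (g * h)%g.
Proof. by move=> gu hv p; rewrite braid_actM gu hv addrAC addrA. Qed.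

Lemma translationV u g : translation_by u g -> translation_by (- u)%R g^-1%g.
Proof.
move=> gu p; apply: (can_inj (braid_actK g)).
by rewrite braid_actVK gu subrK.
Qed.

Lemma translation_conj u g h :
  {morph braid_act h : p q / (p + q)%R} -> translation_by u g ->
  translation_by (braid_act h u) (h * g * h^-1)%g.
Proof. by move=> hD gu p; rewrite !braid_actM gu hD braid_actVK. Qed.

Lemma sigma_act :
  (forall x y : int, braid_act sigma1 (x, y) = (x + y, y)%R) *
  (forall x y : int, braid_act sigma1^-1%g (x, y) = (x - y, y)%R) *
  (forall x y : int, braid_act sigma2 (x, y) = (x, y - x)%R) *
  (forall x y : int, braid_act sigma2^-1%g (x, y) = (x, y + x)%R) *
  (forall x y : int, braid_act sigma3 (x, y) = (x + y + 1, y)%R).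
Proof.
by do 4?split; move=> x y;
  [exact: braid_act_class | exact: braid_actV_class | exact: braid_act_class
  | exact: braid_actV_class | exact: braid_act_class].
Qed.

Lemma translation_a : translation_by (0, -1)%R (hnn_val Ga).
Proof.
by case=> x y; rewrite /= !braid_actM !sigma_act; congr pair; rewrite /=; ring.
Qed.

Lemma translation_b : translation_by (1, 0)%R (hnn_val Gb).
Proof.
by case=> x y; rewrite /= !braid_actM !sigma_act; congr pair; rewrite /=; ring.
Qed.

Lemma act_t2 x y : braid_act (hnn_val Gt2) (x, y) = (x - y, y + y - x)%R.
Proof. by rewrite /= !braid_actM !sigma_act; congr pair; rewrite /=; ring. Qed.

Lemma act_t2D : {morph braid_act (hnn_val Gt2) : p q / (p + q)%R}.
Proof.
move=> [x y] [z t]; rewrite -[((x, y) + _)%R]/(x + z, y + t)%R !act_t2.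
by congr pair; rewrite /=; ring.
Qed.

Lemma braid_of_word_cons l w :
  braid_of_word (l :: w) = (eval_letter hnn_val l * braid_of_word w)%g.
Proof. exact: big_cons. Qed.

Lemma braid_of_word_cat u v :
  braid_of_word (u ++ v) = (braid_of_word u * braid_of_word v)%g.
Proof. exact: big_cat. Qed.

Lemma braid_of_word_fix0 w :
  Defs.over [:: Gt; Gt1; Gt2] w -> braid_act (braid_of_word w) 0%R = 0%R.
Proof.
have fixV g : braid_act g 0%R = 0%R -> braid_act g^-1%g 0%R = 0%R.
  by move=> g0; rewrite -[in LHS]g0 braid_actK.
have fix1 : braid_act sigma1 0%R = 0%R by rewrite [LHS]sigma_act.
have fix2 : braid_act sigma2 0%R = 0%R by rewrite [LHS]sigma_act.
have fix0 x : x \in [:: Gt; Gt1; Gt2] -> braid_act (hnn_val x) 0%R = 0%R.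
  by rewrite !inE => /or3P[] /eqP->; rewrite /= ?expgS ?expg0 ?mulg1 ?invgM;
    rewrite ?braid_actM !(fix1, fix2, fixV).
elim: w => [|[x b] w IH] /=.
  by rewrite /braid_of_word /eval_word big_nil braid_act1.
case/andP=> /fix0 x0 /IH w0; rewrite braid_of_word_cons braid_actM w0.
by case: b => //; exact: fixV.
Qed.

Definition l1norm (v : plane) : nat := `|v.1|%N + `|v.2|%N.

Lemma translation_length W :
  Defs.over [:: Ga; Gb] W ->
  exists2 u, translation_by u (braid_of_word W) & l1norm u <= size W.
Proof.
elim: W => [|[x b] W IH] /=.
  exists 0%R => //; rewrite /braid_of_word /eval_word big_nil.
  exact: translation1.
case/andP=> xab /IH[u Wu leu].
have [v xv lev]: exists2 v, translation_by v (hnn_val x) & l1norm v = 1.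
  move: xab; rewrite !inE => /orP[] /eqP->.
  - by exists (0, -1)%R => //; exact: translation_a.
  - by exists (1, 0)%R => //; exact: translation_b.
exists ((if b then - v else v) + u)%R.
  rewrite braid_of_word_cons; apply: translationM Wu.
  by case: b => //; exact: translationV.
by case: b; move: leu lev; rewrite /l1norm /=; lia.
Qed.

(** The translation vector of beta is read off from the factor W alone, because
    the factor t^p V fixes the origin. *)
Lemma normal_form_length beta u v :
  translation_by u beta -> is_HNN_normal_form beta v -> l1norm u <= size v.
Proof.
move=> bu [vb [p [V [W [def_v /andP[Vt _] /andP[Wab _]]]]]].
move: bu; rewrite -{}vb {}def_v => bu.
have [u' Wu' leu'] := translation_length Wab.
suff -> : u = u' by rewrite !size_cat; lia.
have /braid_of_word_fix0 : Defs.over [:: Gt; Gt1; Gt2] (t_power p ++ V).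
  rewrite /Defs.over all_cat; apply/andP; split.
    by apply/allP=> l /nseqP[-> _].
  by apply: sub_all Vt => l; rewrite !inE => ->; rewrite orbT.
(* W moves - u' to the origin, where t^p V leaves it; on the other hand beta
   moves - u' to u - u'. *)
have := bu (- u')%R.
rewrite catA braid_of_word_cat braid_actM Wu' addNr => -> /eqP.
by rewrite addrC subr_eq0 => /eqP.
Qed.

Definition stretched_a (n : nat) : word hnn_gen :=
  iter n (fun w => (Gt2, false) :: rcons w (Gt2, true)) [:: (Ga, false)].

Lemma size_stretched_a n : size (stretched_a n) = n.*2.+1.
Proof. by elim: n => //= n IH; rewrite size_rcons IH. Qed.

Lemma stretched_a_translation n :
  exists2 u, translation_by u (braid_of_word (stretched_a n))
           & 2 ^ n <= l1norm u.
Proof.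
(* The vectors stay in the quadrant x >= 0 >= y, where t2 sends (x, - y) to
   (x + y, - (x + 2 y)) and so at least doubles the l1 norm. *)
suff [x [y [xy le_xy]]] : exists x y : nat,
    translation_by (Posz x, - Posz y)%R (braid_of_word (stretched_a n))
    /\ 2 ^ n <= x + y.
  by exists (Posz x, - Posz y)%R => //; rewrite /l1norm /=; lia.
elim: n => [|n [x [y [xy le_xy]]]] /=.
  exists 0, 1; split=> //.
  rewrite /braid_of_word /eval_word big_seq1; exact: translation_a.
exists (x + y), (x + y + y); split; last by rewrite expnS; lia.
rewrite braid_of_word_cons -cats1 braid_of_word_cat mulgA.
rewrite [X in (_ * X)%g]big_seq1.
have -> : (Posz (x + y), - Posz (x + y + y))%R =
          braid_act (hnn_val Gt2) (Posz x, - Posz y)%R.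
  by rewrite act_t2; congr pair; lia.
exact: translation_conj act_t2D xy.
Qed.

(** * The output of a logspace transducer *)

Section OutputLength.
Variables (A : finType) (B : Type) (T : transducer A B).
Implicit Types (w : seq A) (c : config T) (v : seq B).

(** The transition function has a finite domain.  The input symbols are encoded
    by option (option A) to take the maximum over a finite type. *)
Lemma emitted_bounded :
  exists K, forall q i s act, @delta A B T q i s = Some act ->
    size (emitted act) <= K.
Proof.
pose symb (o : option (option A)) :=
  match o with
  | None => LeftEnd | Some None => RightEnd | Some (Some x) => Letter x
  end.
pose len (x : state T * option (option A) * work_symbol T) :=
  let: (q, o, s) := x in
  oapp (fun act => size (emitted act)) 0 (delta q (symb o) s).
exists (\max_x len x) => q i s act def_act.
have [o def_i] : exists o, symb o = i.
  case: i {def_act} => [|x|].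
  - by exists None.
  - by exists (Some (Some x)).
  - by exists (Some None).
by have := leq_bigmax (F := len) (q, o, s); rewrite /= def_i def_act.
Qed.

(** The number of remaining steps is a function of the configuration, so it
    tells apart the configurations of a halting run (halts_in_inj). *)
Fixpoint halts_in w n c : Prop :=
  match n, step w c with
  | 0, None => True
  | n'.+1, Some (c', _) => halts_in w n' c'
  | _, _ => False
  end.

Lemma halts_in_inj w c m n : halts_in w m c -> halts_in w n c -> m = n.
Proof.
elim: m n c => [|m IH] [|n] c //=; case: (step w c) => // -[c' _] hm hn.
by rewrite (IH n c').
Qed.

(** The configurations are indexed by the number of steps that remain, not by
    the number already made, so that halts_in separates them. *)
Lemma halts_from_trace K w c v :
  (forall (c c' : config T) u, step w c = Some (c', u) -> size u <= K) ->
  halts_from w c v -> reachable w c ->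
  exists N, [/\ size v <= K * N, halts_in w N c
    & forall n, n <= N -> exists2 c', reachable w c' & halts_in w n c'].
Proof.
move=> leK; elim=> {c v} [c stop rc | c c' u v cc' _ IH rc].
  have c0 : halts_in w 0 c by rewrite /= stop.
  by exists 0; split=> // n; rewrite leqn0 => /eqP->; exists c.
have [N [lev c'N allN]] := IH (ReachStep rc cc').
have cN : halts_in w N.+1 c by rewrite /= cc'.
exists N.+1; split=> // [|n].
  by rewrite size_cat mulnS leq_add // (leK _ _ _ cc').
by rewrite leq_eqVlt => /orP[/eqP-> | /allN //]; exists c.
Qed.

Lemma reachable_input_pos w c : reachable w c -> input_pos c <= (size w).+1.
Proof.
case=> // {}c c' v _; rewrite /step; case: delta => //= act [<- _] /=.
exact: geq_minr.
Qed.

(** A tape is a function on all of nat; a finite part of it determines a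
    reachable configuration because the rest is still blank. *)
Lemma reachable_blank w L c :
  (forall c', reachable w c' -> work_pos c' < L) -> reachable w c ->
  forall i, L <= i -> work_tape c i = blank T.
Proof.
move=> leL; elim=> {c} // c c' v rc IH; rewrite /step.
case: delta => //= act [<- _] i leLi /=.
have := leL c rc; case: eqP => [<- | _ _]; first by rewrite ltnNge leLi.
exact: IH.
Qed.

(** If the work head stays below L, all that a configuration remembers fits in
    this finite type.  Positions are taken in 'I_L.+1 rather than 'I_L so that
    [inord] applies even when L is not known to be positive. *)
Definition config_code n L c :
    state T * 'I_n.+2 * 'I_L.+1 * {ffun 'I_L -> work_symbol T} :=
  (cur_state c, inord (input_pos c), inord (work_pos c),
   [ffun i : 'I_L => work_tape c i]).

Lemma config_code_inj w L c c' :
  (forall k : config T, reachable w k -> work_pos k < L) ->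
  reachable w c -> reachable w c' ->
  config_code (size w) L c = config_code (size w) L c' -> c = c'.
Proof.
move=> leL rc rc'.
have := (reachable_blank leL rc', reachable_blank leL rc).
have := (reachable_input_pos rc', reachable_input_pos rc).
have := (leL _ rc', leL _ rc).
case: c c' {rc rc'} => [q i j f] [q' i' j' f'] /=.
move=> [lej' lej] [lei' lei] [blf' blf].
case=> -> /(congr1 val) /= ei /(congr1 val) /= ej /ffunP ef.
rewrite !inordK // in ei; rewrite !inordK // in ej; try exact: ltnW.
congr Config => //; apply: funext => k.
have [ltk | lek] := ltnP k L; last by rewrite blf // blf'.
by have := ef (Ordinal ltk); rewrite !ffunE.
Qed.

(** Pigeonhole: each number of remaining steps 0, ..., N is attained at some
    reachable configuration, and these have pairwise distinct codes. *)
Lemma halting_output_bound K w L v :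
  (forall (c c' : config T) u, step w c = Some (c', u) -> size u <= K) ->
  (forall k : config T, reachable w k -> work_pos k < L) -> outputs T w v ->
  size v <= K * (#|state T| * (size w).+2 * L.+1 * #|work_symbol T| ^ L).
Proof.
move=> leK leL /(halts_from_trace leK) /(_ (ReachInit T w)) [N [lev _ allN]].
apply: leq_trans lev _; rewrite leq_mul2l; apply/orP; right; apply: ltnW.
have /fin_all_exists[f fP] : forall n : 'I_N.+1,
    exists c, reachable w c /\ halts_in w n c.
  by move=> n; have [c rc cn] := allN n (ltn_ord n); exists c.
suff /leq_card : injective (config_code (size w) L \o f).
  by rewrite !card_prod !card_ord card_ffun card_ord.
move=> m n /= eq_mn; have [rm hm] := fP m; have [rn hn] := fP n.
apply: val_inj; apply: (halts_in_inj hm).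
by rewrite (config_code_inj leL rm rn eq_mn).
Qed.

(** The bound 2^(d (log n + 1)) is a polynomial in n; in this form a constant
    factor C is absorbed by adding C to d, as log n + 1 > 0. *)
Lemma logspace_output_poly :
  logspace T -> exists d, forall w v, outputs T w v ->
    size v <= 2 ^ (d * (trunc_log 2 (size w)).+1).
Proof.
case=> c leL; have [K leK] := emitted_bounded.
exists (K + #|state T| + 2 + c.+1 + #|work_symbol T| * c) => w v out.
set l := (trunc_log 2 (size w)).+1.
have leKstep c1 c2 u : step w c1 = Some (c2, u) -> size u <= K.
  rewrite /step; case E: delta => [act|] //= [_ <-]; exact: leK E.
apply: leq_trans (halting_output_bound leKstep (leL w) out) _; rewrite -/l.
have l_gt0 : 0 < l by [].
have n_lt : size w < 2 ^ l by exact: trunc_log_ltn.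
have lt2X k : k < 2 ^ k by exact: ltn_expl.
have lt2Xl k : k <= 2 ^ (k * l).
  by apply: leq_trans (ltnW (lt2X k)) _; rewrite leq_exp2l // leq_pmulr.
(* The factors are bounded one by one; n + 2 <= 2^(2 l) accounts for the
   summand 2 of the exponent. *)
rewrite !mulnDl !expnD !mulnA -!mulnA.
apply: leq_mul => //; apply: leq_mul => //; apply: leq_mul; [|apply: leq_mul].
- have : 2 <= 2 ^ l by rewrite -{1}(expn1 2) leq_exp2l.
  by rewrite mulnC expnM; nia.
- apply: leq_trans (ltnW (lt2X _)) _; rewrite leq_exp2l // mulSn; lia.
- rewrite [leqRHS]expnM; case: (posnP (c * l)) => [-> // | cl_gt0].
  by rewrite leq_exp2r // ltnW.
Qed.
End OutputLength.

(** * Exponential against polynomial length *)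

Lemma exp2_gt_linear d : exists k, d * k.+2 < 2 ^ k.
Proof.
(* 6 is the least k with k (k + 2) < 2^k for it and all larger numbers. *)
exists (d + 6); suff: (d + 6) * (d + 6).+2 < 2 ^ (d + 6) by nia.
by elim: d => [|d IH] //; rewrite addSn expnS; nia.
Qed.

Theorem theorem5p4 :
  ~ exists T : transducer (hnn_gen * bool)%type (hnn_gen * bool)%type,
      logspace T /\
      forall w : word hnn_gen,
        exists v : word hnn_gen,
          outputs T w v /\ is_HNN_normal_form (braid_of_word w) v.
Proof.
case=> T [/logspace_output_poly[d led] computes].
have [k lt_k] := exp2_gt_linear d.
(* The output has length at least 2^(2^k), but the input, of length 2^(k+1) + 1,
   allows only 2^(d (k + 2)). *)
have [v [/led lev nf_v]] := computes (stretched_a (2 ^ k)).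
have [u tr_u leu] := stretched_a_translation (2 ^ k).
have log_size : trunc_log 2 (size (stretched_a (2 ^ k))) = k.+1.
  have : 0 < 2 ^ k by rewrite expn_gt0.
  by move=> ?; apply: trunc_log_eq; rewrite // size_stretched_a !expnS; lia.
have := leq_trans leu (leq_trans (normal_form_length tr_u nf_v) lev).
by rewrite log_size leq_exp2l // leqNgt lt_k.
Qed.
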